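(* Let $(V,E)$ be a (possibly infinite) connected interval graph. Let $W=\{(a,b)\in V\times V \mid \neg\, a\,E\,b\}$ and define a relation $Q$ on $W$ by $(a,b)\,Q\,(c,d)$ if and only if $a\,E\,c$ and $b\,E\,d$. Then the following are equivalent: (1) $(V,E)$ is uniquely orderable; (2) $(V,E)$ does not contain a buried subgraph; (3) the graph $(W,Q)$ has exactly two connected components.
   Context: A graph $(V,E)$ has $E\subseteq V\times V$ symmetric (not necessarily irreflexive). A graph $(V,E)$ is an interval graph if it is reflexive and there exist a linear order $(L,<_L)$ and a map $F$ assigning to each $v\in V$ a nonempty interval $F(v)$ of $L$ (a convex subset) such that $v\,E\,u \iff F(v)\cap F(u)\neq\emptyset$. A strict partial order $\prec$ on $V$ is associated to $(V,E)$ if for all $u,v\in V$: $\neg\, u\,E\,v$ iff ($u\prec v$ or $v\prec u$). $(V,E)$ is uniquely orderable if there is a strict partial order $\prec$ associated to it and the only other strict partial order associated to it is the dual (reverse) of $\prec$. For $B\subseteq V$ let $K(B)=\{v\in V\mid \forall b\in B\,(v\,E\,b)\}$ and $R(B)=V\setminus(B\cup K(B))$. A set $B\subseteq V$ is a buried subgraph of $(V,E)$ if: (i) there are $a,b\in B$ with $\neg\, a\,E\,b$; (ii) $K(B)\cap B=\emptyset$ and $R(B)\neq\emptyset$; (iii) for all $b\in B$ and $r\in R(B)$, $\neg\, b\,E\,r$. A graph is connected if any two vertices are joined by a path $v_0\,E\,v_1\,E\cdots E\,v_n$.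
   Formalization: The equivalence of (2) and (3) is stated only when some two vertices are nonadjacent, since for a complete graph W is empty and (3) fails while (2) holds; a complete graph, whose only associated order is empty and self-dual, counts as uniquely orderable. *)

(* Defs.v *)
From mathcomp Require Import all_boot all_order.
From mathcomp Require Import boolp classical_sets functions cardinality.
From Stdlib Require Import RelationClasses Relation_Operators.

Set Implicit Arguments.
Unset Strict Implicit.
Unset Printing Implicit Defensive.

Local Open Scope classical_set_scope.

(* A graph is a type V (finite or not, possibly empty) with a symmetric edge
   relation E : V -> V -> Prop, which may have loops. *)

Definition convex d (L : orderType d) (I : set L) : Prop :=
  forall x y z : L, I x -> I z -> (x <= y)%O -> (y <= z)%O -> I y.

(* The choice structure carried by orderType is no restriction: classically
   every type has one. *)
Definition interval_graph (V : Type) (E : V -> V -> Prop) : Prop :=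
  Reflexive E /\
  exists (d : Order.disp_t) (L : orderType d) (F : V -> set L),
    (forall v, F v !=set0 /\ convex (F v)) /\
    (forall v u, E v u <-> F v `&` F u !=set0).

(* v_0 E v_1 E ... E v_n, with n = 0 allowed *)
Definition joined (V : Type) (E : V -> V -> Prop) : V -> V -> Prop :=
  clos_refl_trans V E.

Definition connected_graph (V : Type) (E : V -> V -> Prop) : Prop :=
  forall u v, joined E u v.

Definition components (V : Type) (E : V -> V -> Prop) : set (set V) :=
  [set C | exists x, C = [set y | joined E x y]].

Definition associated (V : Type) (E P : V -> V -> Prop) : Prop :=
  StrictOrder P /\ forall u v, ~ E u v <-> (P u v \/ P v u).

(* On a complete graph the only associated order is the empty one, which is its
   own dual; a complete graph is thus uniquely orderable. *)
Definition uniquely_orderable (V : Type) (E : V -> V -> Prop) : Prop :=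
  exists P, associated E P /\
    forall P', associated E P' -> P' = P \/ P' = (fun u v => P v u).

Definition Kset (V : Type) (E : V -> V -> Prop) (B : set V) : set V :=
  [set v | forall b, B b -> E v b].

Definition Rset (V : Type) (E : V -> V -> Prop) (B : set V) : set V :=
  ~` (B `|` Kset E B).

Definition buried (V : Type) (E : V -> V -> Prop) (B : set V) : Prop :=
  [/\ exists a b, [/\ B a, B b & ~ E a b],
      Kset E B `&` B = set0 /\ Rset E B !=set0 &
      forall b r, B b -> Rset E B r -> ~ E b r].

Definition W (V : Type) (E : V -> V -> Prop) : Type :=
  {p : V * V | ~ E p.1 p.2}.

Definition Q (V : Type) (E : V -> V -> Prop) (p q : W E) : Prop :=
  E (sval p).1 (sval q).1 /\ E (sval p).2 (sval q).2.

(* Main.v *)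
(* Following Gallai's theory of transitive orientations, give a non-edge (a, b)
   the color formed by the Q-components of (a, b) and (b, a). An associated order
   cannot separate Q-joined pairs, so an order is determined by one sign per
   color, and (3) says that there is a single color.
   The span of a color (its set of end points) is a module: an outside vertex is
   E-related to all of it or to none of it. If some outside vertex is related to
   none of it, then the span minus its universal vertices is buried. So, without
   buried subgraphs, every span is closed under non-adjacency; then in a triangle
   of non-edges no color occurs exactly once, since by Gallai's triangle lemma its
   span would miss the opposite vertex, and it follows that all colors coincide.
   Conversely, a buried B is a module of the associated order, and reversing the
   order inside B only gives an associated order that is neither the original
   nor its dual. *)
Require Import Defs.
From mathcomp Require Import all_boot all_order.
From mathcomp Require Import boolp classical_sets functions cardinality.
From Stdlib Require Import RelationClasses Relation_Operators.

Set Implicit Arguments.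
Unset Strict Implicit.
Unset Printing Implicit Defensive.

Local Open Scope classical_set_scope.

(** * Interval representations: order by position, no induced 4-cycle *)

Definition C4_free (V : Type) (E : V -> V -> Prop) : Prop :=
  forall a b c d, E a c -> E c b -> E b d -> E d a -> E a b \/ E c d.

Definition set_lt d (L : orderType d) (I J : set L) : Prop :=
  forall x y, I x -> J y -> (x < y)%O.

Lemma set_lt_disjoint d (L : orderType d) (I J : set L) :
  set_lt I J -> I `&` J = set0.
Proof.
move=> lt_IJ; apply/seteqP; split=> // x [Ix Jx].
by have := lt_IJ x x Ix Jx; rewrite Order.POrderTheory.ltxx.
Qed.

(** One pair [x0 < y0] decides the order: if [y <= x] with [x] in [A] and [y] in [B], then convexity
    puts [x0] in [B] (when [y <= x0]) or [y] in [A] (when [x0 < y]), against disjointness. *)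
Lemma convex_set_lt_total d (L : orderType d) (I J : set L) :
  convex I -> convex J -> I !=set0 -> J !=set0 -> I `&` J = set0 ->
  set_lt I J \/ set_lt J I.
Proof.
have sep (A B : set L) x0 y0 : convex A -> convex B -> A `&` B = set0 ->
    A x0 -> B y0 -> (x0 < y0)%O -> set_lt A B.
  move=> cA cB AB0 Ax0 By0 lt0 x y Ax By.
  have [//|le_yx] := Order.TotalTheory.ltP x y.
  have [le_yx0|lt_x0y] := Order.TotalTheory.leP y x0.
    have Bx0 : B x0 by exact: cB By By0 le_yx0 (Order.POrderTheory.ltW lt0).
    by suff: set0 x0 by []; rewrite -AB0.
  have Ay : A y by exact: cA Ax0 Ax (Order.POrderTheory.ltW lt_x0y) le_yx.
  by suff: set0 y by []; rewrite -AB0.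
move=> cI cJ [x0 Ix0] [y0 Jy0] IJ0.
have [lt0|lt0|eq0] := Order.TotalTheory.ltgtP x0 y0.
- by left; exact: sep Ix0 Jy0 lt0.
- by right; apply: sep Jy0 Ix0 lt0 => //; rewrite setIC.
- by suff: set0 x0 by []; rewrite -IJ0; split=> //; rewrite eq0.
Qed.

Lemma interval_graph_associated (V : Type) (E : V -> V -> Prop) :
  interval_graph E -> exists P, associated E P.
Proof.
move=> [_ [d [L [F [F_itv EF]]]]].
exists (fun u v => set_lt (F u) (F v)); split; first split.
- move=> u /set_lt_disjoint; rewrite setIid => Fu0.
  by have [[x]] := F_itv u; rewrite Fu0.
- move=> u v w Puv Pvw x y Fx Fy; have [[z Fz] _] := F_itv v.
  exact: Order.POrderTheory.lt_trans (Puv _ _ Fx Fz) (Pvw _ _ Fz Fy).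
move=> u v; rewrite EF; split.
  have [[nu cu] [nv cv]] := (F_itv u, F_itv v).
  by move=> /set0P/negP/negPn/eqP; exact: convex_set_lt_total.
by case=> /set_lt_disjoint; [|rewrite setIC]; move=> ->; case.
Qed.

(** Each side of the cycle yields a point common to two intervals. If both diagonals were non-edges,
    their intervals would be ordered by position, and two points from opposite sides would each
    precede the other. *)
Lemma interval_graph_C4_free (V : Type) (E : V -> V -> Prop) :
  interval_graph E -> C4_free E.
Proof.
move=> [_ [d [L [F [F_itv EF]]]]] a b c e.
have lt_total u v : ~ E u v -> set_lt (F u) (F v) \/ set_lt (F v) (F u).
  have [[nu cu] [nv cv]] := (F_itv u, F_itv v).
  by rewrite EF => /set0P/negP/negPn/eqP; exact: convex_set_lt_total.
rewrite !(EF a c, EF c b, EF b e, EF e a).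
move=> [x [ax cx]] [y [cy b_y]] [z [bz ez]] [t [et a_t]].
apply: contrapT => /not_orP[/lt_total ab /lt_total ce].
have noloop (p q : L) : (p < q)%O -> (q < p)%O -> False.
  by move=> pq /(Order.POrderTheory.lt_trans pq); rewrite Order.POrderTheory.ltxx.
by case: ab => ab; case: ce => ce;
  [apply: (noloop t y)|apply: (noloop x z)|apply: (noloop z x)|apply: (noloop y t)]; auto.
Qed.

(** * Colors of non-edges *)

Section NonEdges.
Context {V : Type} {E : V -> V -> Prop}.
Hypotheses (E_refl : Reflexive E) (E_sym : Symmetric E) (E_C4 : C4_free E).

Lemma nonedge_sym x y : ~ E x y -> ~ E y x.
Proof. by move=> NE /E_sym. Qed.

Definition nonedge {x y} (NE : ~ E x y) : W E := exist _ (x, y) NE.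

Definition flip (p : W E) : W E := nonedge (nonedge_sym (svalP p)).

Lemma flipK p : flip (flip p) = p.
Proof. by case: p => -[x y] NE; apply: eq_exist. Qed.

Lemma joined_flip p q : joined (@Q V E) p q -> joined (@Q V E) (flip p) (flip q).
Proof.
elim=> [{}p {}q [E1 E2]|r|{}p r {}q _ pr _ rq].
- by apply: rt_step; split.
- exact: rt_refl.
- exact: rt_trans pr rq.
Qed.

Lemma joinedQ_sym p q : joined (@Q V E) p q -> joined (@Q V E) q p.
Proof.
elim=> [{}p {}q [E1 E2]|r|{}p r {}q _ pr _ rq].
- by apply: rt_step; split; apply: E_sym.
- exact: rt_refl.
- exact: rt_trans rq pr.
Qed.

(* By C4-freeness a Q-step factors into two Q-steps, each moving one end only. *)
Lemma joinedQ_ind (Phi : V -> V -> Prop) :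
  (forall x y y', ~ E x y -> ~ E x y' -> E y y' -> Phi x y -> Phi x y') ->
  (forall x x' y, ~ E x y -> ~ E x' y -> E x x' -> Phi x y -> Phi x' y) ->
  forall p q : W E, joined (@Q V E) p q ->
    Phi (sval p).1 (sval p).2 -> Phi (sval q).1 (sval q).2.
Proof.
move=> stepr stepl p q.
elim=> [{p q} [[b c] /= bc] [[b' c'] /= b'c'] [/= Eb Ec] Phibc|r //|]; last first.
  by move=> {}p r {}q _ pr _ rq /pr.
have [bc'|/contrapT bc'] := EM (~ E b c').
  by apply: (stepl b) => //; apply: (stepr _ c).
have [b'c|/contrapT b'c] := EM (~ E b' c).
  by apply: (stepr _ c) => //; apply: (stepl b).
(* Otherwise [b], [b'], [c], [c'] is a 4-cycle whose diagonals are the two given non-edges. *)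
by have [] := E_C4 Eb b'c Ec (E_sym bc').
Qed.

(** Taking vertices rather than an element of [W] avoids carrying proofs of non-adjacency; on an
    edge the color is empty. *)
Definition color x y : set (W E) :=
  [set p | exists2 q, joined (@Q V E) q p & sval q = (x, y) \/ sval q = (y, x)].

Lemma colorC x y : color x y = color y x.
Proof. by apply/seteqP; split=> p [q qp [?|?]]; exists q; auto. Qed.

Lemma sval_W_inj (p q : W E) : sval p = sval q -> p = q.
Proof. by case: p q => [p Np] [q Nq] /= e; apply: eq_exist. Qed.

Lemma nonedgeE p x y (NE : ~ E x y) : sval p = (x, y) -> p = nonedge NE.
Proof. by move=> e; apply: sval_W_inj. Qed.

Lemma joined_color p q : joined (@Q V E) p q ->
  color (sval p).1 (sval p).2 = color (sval q).1 (sval q).2.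
Proof.
have sub p' q' : joined (@Q V E) p' q' ->
    color (sval p').1 (sval p').2 `<=` color (sval q').1 (sval q').2.
  move=> pq r [s sr e].
  have [e'|e'] : s = p' \/ s = flip p'.
    by case: e => e; [left|right]; apply: sval_W_inj; rewrite e //; case: (sval p').
  - exists q'; last by left; case: (sval q').
    by apply: rt_trans (joinedQ_sym pq) _; rewrite -e'.
  - exists (flip q'); last by right.
    by apply: rt_trans (joinedQ_sym (joined_flip pq)) _; rewrite -e'.
by move=> pq; apply/seteqP; split; apply: sub => //; exact: joinedQ_sym.
Qed.

Lemma color_stepr {x y y'} : ~ E x y -> ~ E x y' -> E y y' -> color x y = color x y'.
Proof.
move=> xy xy' yy'.
by apply: (@joined_color (nonedge xy) (nonedge xy')); apply: rt_step; split.
Qed.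

Lemma color_stepl {x x' y} : ~ E x y -> ~ E x' y -> E x x' -> color x y = color x' y.
Proof.
by move=> xy x'y xx'; rewrite colorC (color_stepr (nonedge_sym xy) (nonedge_sym x'y)) // colorC.
Qed.

Lemma color_eq_joined {x y x' y'} (NE : ~ E x y) (NE' : ~ E x' y') :
  color x y = color x' y' ->
  joined (@Q V E) (nonedge NE) (nonedge NE') \/
  joined (@Q V E) (nonedge NE) (flip (nonedge NE')).
Proof.
move=> e.
have : color x y (nonedge NE') by rewrite e; exists (nonedge NE'); [exact: rt_refl|left].
move=> [q qp [eq|eq]]; [left|right].
  by rewrite -(nonedgeE NE eq).
have -> : nonedge NE = flip q by apply: sval_W_inj; rewrite /= eq.
exact: joined_flip.
Qed.

(** For a symmetric [Phi], moving the first end reduces to moving the second. *)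
Lemma color_ind (Phi : V -> V -> Prop) :
  (forall x y, Phi x y -> Phi y x) ->
  (forall x y y', ~ E x y -> ~ E x y' -> E y y' -> Phi x y -> Phi x y') ->
  forall {x y x' y'}, ~ E x y -> ~ E x' y' -> color x y = color x' y' ->
    Phi x y -> Phi x' y'.
Proof.
move=> PhiC Phir x y x' y' NE NE' e Phixy.
have Phil u u' v : ~ E u v -> ~ E u' v -> E u u' -> Phi u v -> Phi u' v.
  by move=> uv u'v uu' /PhiC/(Phir _ _ _ (nonedge_sym uv) (nonedge_sym u'v) uu')/PhiC.
by have [/(joinedQ_ind Phir Phil)|/(joinedQ_ind Phir Phil)] :=
  color_eq_joined NE NE' e; move=> /(_ Phixy)//= /PhiC.
Qed.

(** * Spans as modules, and buried subgraphs *)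

Definition span a b : set V :=
  [set x | exists2 y, ~ E x y & color x y = color a b].

(** Walk through the color from [u u'] to [v v'], keeping [x] non-adjacent to both ends: were [x]
    adjacent to a new end [t'], the pair [x s] would have the color of [s t'], and [x] would be in
    the span. *)
Lemma span_mod a b x u v :
  ~ E a b -> ~ span a b x -> span a b u -> span a b v -> ~ E x u -> ~ E x v.
Proof.
move=> ab Nx [u' uu' cu] [v' vv' cv] xu.
suff: [/\ ~ E x v, ~ E x v' & color v v' = color a b] by case.
have step s t t' : ~ E s t -> ~ E s t' -> E t t' ->
    [/\ ~ E x s, ~ E x t & color s t = color a b] ->
    [/\ ~ E x s, ~ E x t' & color s t' = color a b].
  move=> st st' tt' [xs xt cst]; have cst' := color_stepr st st' tt'.
  split=> //; last by rewrite -cst'.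
  move=> xt'; apply: Nx; exists s => //; rewrite -cst cst' colorC.
  by apply: color_stepr => //; exact: nonedge_sym.
apply: (color_ind (Phi := fun s t => [/\ ~ E x s, ~ E x t & color s t = color a b]) _ step uu' vv').
- by move=> s t [xs xt cst]; split=> //; rewrite colorC.
- by rewrite cu cv.
split=> // xu'; apply: Nx; exists u => //; rewrite -cu colorC.
by apply: color_stepr => //; exact: nonedge_sym.
Qed.

(** Gallai's triangle lemma. The invariant [Phi] spreads from [b c] over its whole color; a pair
    [a y] of that color would then make [a] non-adjacent to itself. *)
Lemma triangle_span a b c : ~ E a b -> ~ E a c -> ~ E b c ->
  color a b <> color b c -> color a c <> color b c -> ~ span b c a.
Proof.
move=> ab ac bc Nab Nac [y ay cay].
pose Phi s t := [/\ ~ E a s, ~ E a t, color s t = color b c,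
  color a s <> color b c & color a t <> color b c].
suff [] : Phi a y by move=> /(_ (E_refl a)).
apply: (color_ind (Phi := Phi) _ _ bc ay (esym cay)) => //.
  by move=> s t [? ? ? ? ?]; split; rewrite // colorC.
move=> s t t' st st' tt' [As At cst Ns Nt].
have cst' := color_stepr st st' tt'.
have At' : ~ E a t'.
  move=> at'; apply: Ns; rewrite -cst cst' colorC.
  by apply: color_stepr => //; exact: nonedge_sym.
by split; rewrite // -?cst' // -(color_stepr At At').
Qed.

(** Deleting the universal vertices of [M] empties the intersection of [B] with K(B), since a vertex
    adjacent to all of [B] is adjacent to all of [M]. A vertex outside [B] is either universal in
    [M], hence in K(B), or outside [M], where one neighbor in [M] forces all. *)
Lemma buried_of_mod (M : set V) a b r :
  (forall x u v, ~ M x -> M u -> M v -> ~ E x u -> ~ E x v) ->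
  M a -> M b -> ~ E a b -> ~ M r -> ~ E r a ->
  buried E (M `\` Kset E M).
Proof.
move=> modM Ma Mb ab Mr ra; set B := M `\` _.
have Ba : B a by split=> // /(_ b Mb).
have KB v : Kset E B v -> Kset E M v.
  move=> Kv; have [Mv|Mv] := EM (M v); last first.
    by move=> u Mu; apply: contrapT => /(modM _ _ _ Mv Mu Ma); apply; exact: Kv.
  move=> u Mu; have [Ku|Ku] := EM (Kset E M u); first exact/E_sym/Ku.
  exact: Kv.
split.
- exists a, b; split=> //; split=> // /(_ a Ma) ba; exact/ab/E_sym.
- split; first by apply/seteqP; split=> // v [/KB Kv [_ /(_ Kv)]].
  by exists r => -[[]|/(_ a Ba)].
move=> u s [Mu Ku] Rs us; apply: Rs.
have [Ms|Ms] := EM (M s).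
  have [Ks|Ks] := EM (Kset E M s); last by left.
  by right => v [Mv _]; exact: Ks.
right => v [Mv _]; apply: contrapT => sv.
by apply: (modM _ _ _ Ms Mv Mu sv); exact: E_sym.
Qed.

Lemma span_closed a b u x :
  ~ (exists B, buried E B) -> ~ E a b -> span a b u -> ~ E x u -> span a b x.
Proof.
move=> NB ab au xu; apply: contrapT => Nx; apply: NB.
have aa : span a b a by exists b.
have bb : span a b b by exists a; [exact: nonedge_sym|rewrite colorC].
exists (span a b `\` Kset E (span a b)); apply: (buried_of_mod _ aa bb ab Nx).
  by move=> y v w; exact: span_mod.
exact: span_mod ab Nx au aa xu.
Qed.

Lemma color_triangle a b c : ~ (exists B, buried E B) ->
  ~ E a b -> ~ E a c -> ~ E b c ->
  color a b = color b c \/ color a c = color b c.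
Proof.
move=> NB ab ac bc; apply: contrapT => /not_orP[Nab Nac].
apply: (triangle_span ab ac bc Nab Nac).
by apply: (span_closed NB bc (u := b)) => //; exists c.
Qed.

Lemma color_constant a b c d : ~ (exists B, buried E B) ->
  ~ E a b -> ~ E c d -> color a b = color c d.
Proof.
move=> NB ab cd.
have aa : span a b a by exists b.
have bb : span a b b by exists a; [exact: nonedge_sym|rewrite colorC].
(* Otherwise [d] is outside the span as well, both are adjacent to [a] and [b], and [a], [c], [b],
   [d] is an induced 4-cycle. *)
have [y cy cyab] : span a b c.
  apply: contrapT => Nc.
  have Nd : ~ span a b d by move=> /(span_closed NB ab)/(_ cd).
  have adj x u : ~ span a b x -> span a b u -> E x u.
    by move=> Nx xu; apply: contrapT => /(span_closed NB ab xu).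
  have [] := E_C4 (E_sym (adj c a Nc aa)) (adj c b Nc bb)
                  (E_sym (adj d b Nd bb)) (adj d a Nd aa) => //.
rewrite -cyab.
(* Now [c y] and [c d] share an end: either [y E d] and one step suffices, or [c], [d], [y] is a
   triangle of non-edges, in which neither [c d] nor [c y] can have a color of its own. *)
have [/E_sym dy|yd] := EM (E y d); first by rewrite (color_stepr cd cy dy).
have [dc dy] := (nonedge_sym cd, nonedge_sym yd); have yc := nonedge_sym cy.
have [e1|e1] := color_triangle NB yc yd cd; first by rewrite colorC.
have [e2|e2] := color_triangle NB dc dy cy; first by rewrite -e2 colorC.
by rewrite -e1 -e2 colorC.
Qed.

(** * Associated orders and the number of Q-components *)

Lemma associated_step P p q : associated E P -> joined (@Q V E) p q ->
  P (sval p).1 (sval p).2 -> P (sval q).1 (sval q).2.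
Proof.
move=> [[Pirr Ptr] PE]; apply: joinedQ_ind.
(* If [y'] were below [x], transitivity would compare the adjacent [y'] and [y]. *)
- move=> x y y' _ /PE[//|y'x] yy' xy.
  by have [] // := (PE y y').2 (or_intror (Ptr _ _ _ y'x xy)).
- move=> x x' y _ /PE[//|yx'] xx' xy.
  by have [] // := (PE x x').2 (or_introl (Ptr _ _ _ xy yx')).
Qed.

(** Hence every color consists of exactly two components, exchanged by [flip]. *)
Lemma not_joined_flip P a b (ab : ~ E a b) : associated E P ->
  ~ joined (@Q V E) (nonedge ab) (flip (nonedge ab)).
Proof.
move=> asP; have [[Pirr Ptr] PE] := asP.
move=> j; have j' := joinedQ_sym j.
have [Pab|Pba] := (PE a b).1 ab.
- by have /= := associated_step asP j Pab; move/(Ptr _ _ _ Pab)/Pirr.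
- by have /= := associated_step asP j' Pba; move/(Ptr _ _ _ Pba)/Pirr.
Qed.

Lemma unique_of_color_constant P : associated E P ->
  (forall a b c d, ~ E a b -> ~ E c d -> color a b = color c d) ->
  uniquely_orderable E.
Proof.
move=> asP cst; exists P; split=> // P' asP'.
have [[a [b ab]]|complete] := EM (exists a b, ~ E a b); last first.
  left; apply/funext => x; apply/funext => y; apply/propext.
  by split=> Pxy; case: complete; exists x, y; [apply/(proj2 asP' x y)|apply/(proj2 asP x y)]; left.
(* With a single color, the sign at [a b] determines the whole order. *)
have det P1 P2 : associated E P1 -> associated E P2 -> P1 a b -> P2 a b -> P1 = P2.
  suff sub P3 P4 : associated E P3 -> associated E P4 -> P3 a b -> P4 a b ->
      forall x y, P3 x y -> P4 x y.
    move=> as1 as2 P1ab P2ab; apply/funext => x; apply/funext => y; apply/propext.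
    by split; exact: sub.
  move=> as3 as4 P3ab P4ab x y P3xy.
  have xy : ~ E x y by apply/(proj2 as3 x y); left.
  have [j|j] := color_eq_joined ab xy (cst _ _ _ _ ab xy).
    exact: (associated_step as4 j P4ab).
  have /= P3yx := associated_step as3 j P3ab.
  have [[Pirr Ptr] _] := as3; by case: (Pirr x); exact: Ptr P3xy P3yx.
have dual P1 : associated E P1 -> associated E (fun u v => P1 v u).
  move=> [[Pirr Ptr] PE]; split; first by split=> // x y z yx zy; exact: Ptr zy yx.
  by move=> u v; rewrite PE; split=> -[]; auto.
have [Pab|Pba] := (proj2 asP a b).1 ab; have [P'ab|P'ba] := (proj2 asP' a b).1 ab.
- by left; exact: det.
- by right; rewrite -(det _ _ (dual _ asP') asP P'ba Pab).
- by right; exact: det _ _ asP' (dual _ asP) P'ab Pba.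
- left; have e := det _ _ (dual _ asP') (dual _ asP) P'ba Pba.
  apply/funext => x; apply/funext => y; exact: (congr1 (fun R => R y x) e).
Qed.

Lemma components_color_constant P a b : associated E P -> ~ E a b ->
  (components (@Q V E) #= `I_2)%card <->
  (forall a b c d, ~ E a b -> ~ E c d -> color a b = color c d).
Proof.
move=> asP ab.
pose C p := [set q | joined (@Q V E) p q].
have CC p : components (@Q V E) (C p) by exists p.
have CE p q : C p = C q -> joined (@Q V E) p q.
  by move=> e; suff: C p q by []; rewrite e; exact: rt_refl.
have EC p q : joined (@Q V E) p q -> C p = C q.
  move=> pq; apply/seteqP; split=> r; last exact: rt_trans.
  by apply: rt_trans; exact: joinedQ_sym.
have Nflip : C (nonedge ab) <> C (flip (nonedge ab)).
  by move/CE; exact: not_joined_flip asP.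
split=> [/card_set_bijP[f [f2 fI _]]|cst].
  suff colE c d : ~ E c d -> color c d = color a b.
    by move=> *; rewrite colE // colE.
  move=> cd.
  have fne p q : f (C p) = f (C q) -> joined (@Q V E) p q.
    by move/fI => /(_ (mem_set (CC p)) (mem_set (CC q))) /CE.
  have : f (C (nonedge cd)) = f (C (nonedge ab)) \/
         f (C (nonedge cd)) = f (C (flip (nonedge ab))).
    (* The components of [a b] and of its flip already take both values 0 and 1, so that of [c d]
       shares a value with one of them. *)
    have : f (C (nonedge ab)) <> f (C (flip (nonedge ab))).
      by move/fne; exact: not_joined_flip asP.
    have /= := f2 _ (CC (nonedge ab)).
    have /= := f2 _ (CC (flip (nonedge ab))).
    have /= := f2 _ (CC (nonedge cd)).
    by case: (f _) => [|[|]] //; case: (f _) => [|[|]] //; case: (f _) => [|[|]] // *; auto.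
  by case=> /fne /joined_color //= ->; rewrite colorC.
have two X : components (@Q V E) X -> X = C (nonedge ab) \/ X = C (flip (nonedge ab)).
  move=> [[[c d] cd] ->].
  have [j|j] := color_eq_joined ab cd (cst _ _ _ _ ab cd).
    by left; apply/esym/EC.
  right; apply: EC; have := joined_flip j; rewrite flipK; exact: joinedQ_sym.
apply/card_set_bijP; exists (fun X => nat_of_bool `[< X = C (nonedge ab) >]); split.
- by move=> X _ /=; case: asboolP.
- move=> X Y /set_mem/two[] -> /set_mem/two[] -> //; rewrite (asboolT erefl) asboolF //;
  exact: nesym.
- move=> [|[|]]//= _.
    by exists (C (flip (nonedge ab))); [exact: CC|rewrite asboolF //; exact: nesym].
  by exists (C (nonedge ab)); [exact: CC|rewrite asboolT].
Qed.
End NonEdges.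

(** * Reversing an order inside a buried subgraph *)

Lemma buried_not_unique (V : Type) (E : V -> V -> Prop) (B : set V) :
  Symmetric E -> buried E B -> ~ uniquely_orderable E.
Proof.
move=> E_sym [[a [b [Ba Bb ab]]] [_ [r Rr]] BR] [P [[[Pirr Ptr] PE] uniqP]].
have Br : ~ B r by move=> Br; apply: Rr; left.
(* A vertex outside [B] with a neighbor in [B] is not in R(B), hence is in K(B). *)
have far x v : ~ B x -> B v -> E x v -> forall u, B u -> E x u.
  move=> Bx Bv xv u Bu; apply: contrapT => xu.
  have : Rset E B x by case=> // /(_ u Bu).
  by move/(BR v x Bv); apply; exact: E_sym.
(* P' substitutes the reverse of P on B for the single vertex a. *)
pose h x := if `[< B x >] then a else x.
pose P' x y := (B x /\ B y /\ P y x) \/ (~ (B x /\ B y) /\ P (h x) (h y)).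
have hB x : B x -> h x = a by move=> Bx; rewrite /h asboolT.
have hN x : ~ B x -> h x = x by move=> Bx; rewrite /h asboolF.
have Eh x y : ~ (B x /\ B y) -> (E x y <-> E (h x) (h y)).
  move=> Nxy; have [Bx|Bx] := EM (B x); have [By|By] := EM (B y).
  - by case: Nxy.
  - rewrite (hB x) // (hN y) //; split=> /E_sym e; apply: E_sym; exact: far e _ _.
  - rewrite (hN x) // (hB y) //; split=> e; exact: far e _ _.
  - by rewrite !hN.
have asP' : associated E P'.
  split; first split.
  - by move=> x [[_ [_ /Pirr]]//|[_ /Pirr]].
  - move=> x y z [[Bx [By yx]]|[Nxy xy]] [[By' [Bz zy]]|[Nyz yz]].
    + by left; split=> //; split=> //; exact: Ptr zy yx.
    + by right; split=> [[_ Bz]|]; [apply: Nyz|rewrite (hB x) // -(hB y)].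
    + by right; split=> [[Bx _]|]; [apply: Nxy|rewrite (hB z) // -(hB y)].
    (* With [x] and [z] both in [B], [h y] would lie strictly between [a] and itself. *)
    + have hxz := Ptr _ _ _ xy yz; right; split=> // -[Bx Bz].
      by move: hxz; rewrite !hB // => /Pirr.
  move=> u v; have [Buv|Nuv] := EM (B u /\ B v).
    by rewrite PE /P'; case: Buv => Bu Bv; split; [case; auto|case=> [] [[? []]|[[]]]; auto].
  by rewrite (Eh _ _ Nuv) PE /P'; split=> [[]|[[[Bu [Bv _]]|[_ ?]]|[[Bv [Bu _]]|[_ ?]]]]; auto;
    by [left; right|right; right; split=> // -[]; auto|case: Nuv].
have Bar : ~ (B a /\ B r) by case.
have ar : ~ E a r by exact: BR.
(* The pair [a b] inside [B] separates [P'] from [P]; the pair [a r], which keeps its sign,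
   separates [P'] from the dual. *)
case: (uniqP _ asP') => e.
- have P'ab : P' a b <-> P b a by split=> [[[_ [_ ]]//|[[]]//]|]; left.
  rewrite e in P'ab; have [Pab|Pba] := (PE a b).1 ab.
    exact: Pirr _ (Ptr _ _ _ Pab (P'ab.1 Pab)).
  exact: Pirr _ (Ptr _ _ _ Pba (P'ab.2 Pba)).
- have P'ar : P' a r <-> P a r.
    by rewrite /P' hB // hN //; split=> [[[_ [/Br]]|[]]//|]; right.
  rewrite e in P'ar; have [Par|Pra] := (PE a r).1 ar.
    exact: Pirr _ (Ptr _ _ _ Par (P'ar.2 Par)).
  exact: Pirr _ (Ptr _ _ _ Pra (P'ar.1 Pra)).
Qed.

(** On a complete graph (1) and (2) hold, but [W] is empty and has no component at all; hence the
    non-edge assumed for (3). *)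
Theorem theorem1 (V : Type) (E : V -> V -> Prop)
    (E_sym : Symmetric E)
    (E_interval : interval_graph E)
    (E_connected : connected_graph E) :
  (uniquely_orderable E <-> ~ exists B : set V, buried E B) /\
  ((exists a b, ~ E a b) ->
    ((~ exists B : set V, buried E B) <-> (components (@Q V E) #= `I_2)%card)).
Proof.
have E_refl := E_interval.1; have E_C4 := interval_graph_C4_free E_interval.
have [P asP] := interval_graph_associated E_interval.
have const : ~ (exists B, buried E B) ->
    forall a b c d, ~ E a b -> ~ E c d -> color (E := E) a b = color c d.
  by move=> NB a b c d; exact: color_constant.
have not_buried : uniquely_orderable E -> ~ exists B, buried E B.
  by move=> uniqE [B] /(buried_not_unique E_sym).
split=> [|[a [b ab]]]; first split=> // /const; first exact: unique_of_color_constant E_sym E_C4 _ asP.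
have compE := components_color_constant E_sym E_C4 asP ab.
split=> [/const/compE//|/compE/(unique_of_color_constant E_sym E_C4 asP)].
exact: not_buried.
Qed.
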